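(* Let $\mathbf{y}=\mathbf{G}(x,\mathbf{y})$ be a well-conditioned system with standard solution $\mathbf{T}(x)$ and extreme point $(\rho,\boldsymbol{\tau})$. (a) If $(a,\mathbf{b})$ is a characteristic point of the system then $\Lambda(a,\mathbf{b})\ge 1$. (b) $0<\Lambda\big(a,\mathbf{T}(a)\big)<1$ for $0<a<\rho$.
   Context: Let $m\ge 1$ and $\mathbf{y}=(y_1,\dots,y_m)$. A system $\mathbf{y}=\mathbf{G}(x,\mathbf{y})$ means $y_i=G_i(x,y_1,\dots,y_m)$, $1\le i\le m$, where the $G_i$ are power series; its Jacobian matrix is $J_{\mathbf{G}}(x,\mathbf{y})=\big(\partial G_i/\partial y_j\big)_{1\le i,j\le m}$ (no derivative in $x$). The system is well-conditioned if: (a) each $G_i(x,\mathbf{y})$ is a power series with nonnegative real coefficients; (b) $\mathbf{G}$ is holomorphic in a neighborhood of the origin; (c) $\mathbf{G}(0,\mathbf{y})=\mathbf{0}$; (d) $G_i(x,\mathbf{0})\ne 0$ for all $i$; (e) the system is irreducible, i.e. the nonnegative matrix of power series $J_{\mathbf{G}}$ is irreducible (the directed graph on $\{1,\dots,m\}$ with an edge $i\to j$ whenever $\partial G_i/\partial y_j\neq 0$ is strongly connected); (f) $\partial^2 G_i/\partial y_j\partial y_k\ne 0$ for some $i,j,k$. For a well-conditioned system there is a unique vector $\mathbf{T}(x)=(T_1(x),\dots,T_m(x))$ of formal power series with nonnegative coefficients such that $\mathbf{T}(x)=\mathbf{G}(x,\mathbf{T}(x))$ formally (it satisfies $\mathbf{T}(0)=\mathbf{0}$);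 it is called the standard solution. It is a standard fact that all $T_i$ have the same radius of convergence $\rho\in(0,\infty)$ and that $\tau_i:=T_i(\rho)<\infty$. With $\boldsymbol{\tau}=(\tau_1,\dots,\tau_m)$, the point $(\rho,\boldsymbol{\tau})$ is the extreme point of the system. A characteristic point of the system is a point $(a,\mathbf{b})\in\mathbb{R}^{m+1}$ with all coordinates positive that solves the characteristic system $\mathbf{y}=\mathbf{G}(x,\mathbf{y})$, $\det\big(I-J_{\mathbf{G}}(x,\mathbf{y})\big)=0$ (in particular the series $G_i$ and $\partial G_i/\partial y_j$ converge at $(a,\mathbf{b})$). $\Lambda(a,\mathbf{b})$ denotes the largest real eigenvalue of the nonnegative matrix $J_{\mathbf{G}}(a,\mathbf{b})$, equivalently its spectral radius. *)

(* Defs.v *)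
From HB Require Import structures.
From mathcomp Require Import all_boot all_order all_algebra.
From mathcomp Require Import all_classical all_reals all_analysis.
Set Implicit Arguments.
Unset Strict Implicit.
Unset Printing Implicit Defensive.
Import Order.TTheory GRing.Theory Num.Theory.
Import numFieldNormedType.Exports.
Local Open Scope classical_set_scope.
Local Open Scope ring_scope.

(* Formal power series in R[[x, y_1, ..., y_m]]: [F n k] is the coefficient
   of x^n y^k. *)
Definition mpseries (R : realType) (m : nat) := nat -> {ffun 'I_m -> nat} -> R.

Section MultivariateSeries.
Variables (R : realType) (m : nat).
Implicit Types (F : mpseries R m) (x : R) (y : 'I_m -> R) (j : 'I_m).

Definition mterm F x y (p : nat * {ffun 'I_m -> nat}) : \bar R :=
  (F p.1 p.2 * x ^+ p.1 * \prod_j y j ^+ p.2 j)%:E.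

Definition mconv F x y : Prop := summable [set: _] (mterm F x y).

(* [esum] is meant for nonnegative families, hence the splitting into positive
   and negative parts; the value is meaningful when [mconv F x y] holds. *)
Definition mval F x y : R :=
  fine (esum [set: _] (mterm F x y)^\+ - esum [set: _] (mterm F x y)^\-)%E.

(* Absolute convergence at (x, y) only depends on the moduli of the
   coordinates, so quantifying over real points of a polydisc amounts to
   absolute convergence on the complex polydisc of the same radius. *)
Definition holomorphic_near0 F : Prop :=
  exists2 r : R, 0 < r &
    forall x y, `|x| < r -> (forall j, `|y j| < r) -> mconv F x y.

Definition mpseries_neq0 F : Prop := exists n k, F n k != 0.

Definition mderiv j F : mpseries R m :=
  fun n k => (k j).+1%:R * F n [ffun l => (k l + (l == j))%N].

(* Coefficient of x^N in F(x, T(x)), for univariate series T with T(0) = 0: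
   then only the monomials x^n y^k of F with n <= N and all k_j <= N contribute,
   and T matters only modulo x^(N+1). *)
Definition mcomp_coef F (T : 'I_m -> nat -> R) (N : nat) : R :=
  \sum_(n < N.+1) \sum_(k : {ffun 'I_m -> 'I_N.+1})
    F n [ffun j => k j : nat] *
    (\prod_j (\poly_(l < N.+1) T j l) ^+ k j)`_(N - n).

End MultivariateSeries.

Section Systems.
Variables (R : realType) (m : nat) (G : 'I_m -> mpseries R m).

Definition dependency_edge : rel 'I_m :=
  fun i j => `[< mpseries_neq0 (mderiv j (G i)) >].

Record well_conditioned : Prop := WellConditioned {
  wc_nonneg : forall i n k, 0 <= G i n k;
  wc_holomorphic : forall i, holomorphic_near0 (G i);
  (* G(0, y) = 0 *)
  wc_x0 : forall i k, G i 0%N k = 0;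
  (* G_i(x, 0) != 0 *)
  wc_y0 : forall i, exists n, G i n [ffun=> 0%N] != 0;
  wc_irreducible : forall i j, connect dependency_edge i j;
  wc_nonlinear : exists i j k, mpseries_neq0 (mderiv j (mderiv k (G i)))
}.

Record standard_solution (T : 'I_m -> nat -> R) : Prop := StandardSolution {
  std_nonneg : forall i n, 0 <= T i n;
  std_0 : forall i, T i 0%N = 0;
  std_eq : forall i n, T i n = mcomp_coef (G i) T n
}.

Definition sys_jacobian (x : R) (y : 'I_m -> R) : 'M[R]_m :=
  \matrix_(i, j) mval (mderiv j (G i)) x y.

Definition sys_jacobian_conv (x : R) (y : 'I_m -> R) : Prop :=
  forall i j, mconv (mderiv j (G i)) x y.

Record characteristic_point (a : R) (b : 'I_m -> R) : Prop :=
  CharacteristicPoint {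
  char_a_gt0 : 0 < a;
  char_b_gt0 : forall i, 0 < b i;
  char_conv : forall i, mconv (G i) a b;
  char_jacobian_conv : sys_jacobian_conv a b;
  char_eq : forall i, b i = mval (G i) a b;
  char_det : \det (1%:M - sys_jacobian a b) = 0
}.

(* The largest real eigenvalue: the set of eigenvalues is finite and, for a
   nonnegative matrix with m > 0, nonempty, so that [sup] is a maximum. *)
Definition Lambda (a : R) (b : 'I_m -> R) : R :=
  sup [set l : R | eigenvalue (sys_jacobian a b) l].

End Systems.

Section UnivariateSeries.
Variable R : realType.

Definition conv_radius (f : nat -> R) : \bar R :=
  ereal_sup [set r%:E | r in [set r : R | 0 <= r /\ cvgn (pseries f r)]].

Definition pval (f : nat -> R) (x : R) : R := limn (pseries f x).

Definition extreme_point (m : nat) (T : 'I_m -> nat -> R)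
    (rho : R) (tau : 'I_m -> R) : Prop :=
  forall i, conv_radius (T i) = rho%:E /\
            pseries (T i) rho @ \oo --> tau i.

End UnivariateSeries.

(* Main.v *)
Require Import Defs.
From mathcomp Require Import all_boot all_order all_algebra.
From mathcomp Require Import all_classical all_reals all_analysis.
From mathcomp Require Import ring.
Set Implicit Arguments.
Unset Strict Implicit.
Unset Printing Implicit Defensive.
Import Order.TTheory GRing.Theory Num.Theory.
Import numFieldNormedType.Exports.
Local Open Scope ring_scope.

(* Write J for the Jacobian matrix.
   At a characteristic point det (I - J) = 0 makes 1 an eigenvalue of J.
   For 0 < a < a' < rho put v = T(a') - T(a).  A power series with nonnegative
   coefficients lies above its tangent on increasing arguments, so subtracting
   T(a) = G(a, T(a)) from T(a') = G(a', T(a')) gives v > J v, with strict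
   inequality because G_i(x, 0) is a nonzero series without constant term.
   Pairing a left eigenvector of J with the positive vector v shows that every
   real eigenvalue of J is smaller than 1.  By irreducibility and nonlinearity
   no row of J vanishes, and a nonnegative matrix whose row sums are at least d
   has a real eigenvalue that is at least d. *)

(** * Real eigenvalues of nonnegative matrices *)

Section NonnegativeMatrices.
Context {R : realType} {m : nat}.
Local Open Scope classical_set_scope.
Local Open Scope ring_scope.
Variable A : 'M[R]_m.
Hypothesis A_ge0 : forall i j, 0 <= A i j.

Lemma eigenvalueE_unitmx (B : 'M[R]_m) (l : R) :
  eigenvalue B l = (l%:M - B \notin unitmx).
Proof.
rewrite /eigenvalue /eigenspace kermx_eq0 row_free_unit -opprB.
by rewrite -scaleN1r unitmxZ // unitrN1.
Qed.

(** Eigenvectors are row vectors here. If [u *m A = l *: u], then |l| |u| <= |u| A entrywise, and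
    pairing with the positive [v] gives |l| N <= c N, where N > 0 is the pairing of |u| with [v]. *)
Lemma eigenvalue_le_weighted (v : 'I_m -> R) (c l : R) :
    (forall i, 0 < v i) -> (forall i, \sum_j A i j * v j <= c * v i) ->
  eigenvalue A l -> `|l| <= c.
Proof.
move=> v_gt0 Av /eigenvalueP[u uA u_neq0].
have [k uk] : exists k, u ord0 k != 0.
  apply/existsP; rewrite -negb_forall; apply: contra u_neq0 => /forallP u0.
  by apply/eqP/rowP => k; rewrite mxE; exact/eqP.
pose N := \sum_j `|u ord0 j| * v j.
have N_gt0 : 0 < N.
  rewrite /N (bigD1 k) //=; apply: ltr_pwDl.
    by rewrite mulr_gt0 // normr_gt0.
  by apply: sumr_ge0 => j _; rewrite mulr_ge0 // ltW.
rewrite -(ler_pM2r N_gt0) mulr_sumr.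
apply: (@le_trans _ _ (\sum_j (\sum_i `|u ord0 i| * A i j) * v j)).
  apply: ler_sum => j _; rewrite mulrA ler_pM2r //.
  have -> : `|l| * `|u ord0 j| = `|(u *m A) ord0 j| by rewrite uA mxE normrM.
  rewrite mxE; apply: le_trans (ler_norm_sum _ _ _) _.
  by apply: ler_sum => i _; rewrite normrM (ger0_norm (A_ge0 _ _)).
under eq_bigr do rewrite mulr_suml.
rewrite exchange_big /N mulr_sumr; apply: ler_sum => i _ /=.
under eq_bigr do rewrite -mulrA.
by rewrite -mulr_sumr mulrCA ler_wpM2l.
Qed.

(** Minimum principle: let t be the least ratio x_k / v_k. If t < 0, then x >= t v with equality at
    k, so (A x)_k >= t (A v)_k > t s v_k = s x_k, against the hypothesis on [x]. *)
Lemma subinvariant_monotone (v x : 'I_m -> R) (s : R) :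
    (forall i, 0 < v i) -> (forall i, \sum_j A i j * v j < s * v i) ->
    (forall i, \sum_j A i j * x j <= s * x i) ->
  forall i, 0 <= x i.
Proof.
move=> v_gt0 Av Ax i.
have [k _ k_min] :=
  @Order.TotalTheory.arg_minP _ R _ i xpredT (fun k => x k / v k) isT.
suff: 0 <= x k / v k.
  by move=> /le_trans /(_ (k_min i isT)); rewrite pmulr_lge0 // invr_gt0.
set t := x k / v k; rewrite leNgt; apply/negP => t_lt0.
have tv j : t * v j <= x j by rewrite -ler_pdivlMr //; exact: k_min.
have tvk : t * v k = x k by rewrite /t divfK // gt_eqF.
have : s * x k < \sum_j A k j * x j.
  rewrite -tvk mulrCA.
  apply: (@lt_le_trans _ _ (t * \sum_j A k j * v j)); first by rewrite ltr_nM2l.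
  by rewrite mulr_sumr; apply: ler_sum => j _; rewrite mulrCA ler_wpM2l.
by rewrite ltNge Ax.
Qed.

(* [r] is the infimum of the [s] admitting a positive [v] with [A v < s v].
   If [r - A] were invertible, then [w := (r - A)^-1 1] would be nonnegative,
   because [(s - A) w >= 0] for [s > r] close to [r]; but then [A w < (r - e) w]
   for a small [e > 0]. *)
Lemma eigenvalue_ge_row_sums (d : R) :
    (0 < m)%N -> (forall i, d <= \sum_j A i j) ->
  exists2 r, d <= r & eigenvalue A r.
Proof.
move=> m_gt0 rowA.
pose S := [set s : R | exists2 v : 'I_m -> R, (forall i, 0 < v i) &
  forall i, \sum_j A i j * v j < s * v i].
have S0 : nonempty S.
  (* With constant weight 1, any number above all row sums belongs to [S]. *)
  exists (1 + \sum_i \sum_j A i j), (fun=> 1) => // i.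
  under eq_bigr do rewrite mulr1.
  rewrite mulr1 [X in 1 + X](bigD1 i) //= addrCA ltrDl ltr_pwDl //.
  by apply: sumr_ge0 => k _; exact: sumr_ge0.
(* At an index where [v] is smallest, (A v)_k is at least the k-th row sum times v_k. *)
have dS : lbound S d.
  move=> s [v v_gt0 Av].
  have [k _ k_min] :=
    @Order.TotalTheory.arg_minP _ R _ (Ordinal m_gt0) xpredT v isT.
  rewrite -(ler_pM2r (v_gt0 k)); apply: le_trans (ltW (Av k)).
  apply: (@le_trans _ _ ((\sum_j A k j) * v k)); first by rewrite ler_pM2r.
  by rewrite mulr_suml; apply: ler_sum => j _; rewrite ler_wpM2l // k_min.
have infS : has_inf S by split => //; exists d.
exists (inf S); first exact: lb_le_inf.
set r := inf S; rewrite eigenvalueE_unitmx; apply/negP => rA_unit.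
have [W rW] : exists W : 'cV[R]_m, (r%:M - A) *m W = const_mx 1.
  by exists (invmx (r%:M - A) *m const_mx 1); rewrite mulKVmx.
pose w i := W i ord0.
have rw i : r * w i = 1 + \sum_j A i j * w j.
  have /matrixP/(_ i ord0) := rW.
  by rewrite mulmxBl mul_scalar_mx !mxE => <-; rewrite subrK.
pose M := 1 + \sum_i `|w i|.
have M_gt0 : 0 < M by rewrite ltr_pwDl // sumr_ge0.
have wM i : `|w i| <= M.
  by rewrite /M (bigD1 i) //= addrCA lerDl addr_ge0 // sumr_ge0.
(* As [M] bounds every |w_i|, the tolerance 1/M gives |(s - r) w_i| <= 1, hence (s - A) w = 1 + (s -
   r) w >= 0. *)
have [|s [v v_gt0 Av] sr] := @inf_adherent _ S M^-1 _ infS.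
  by rewrite invr_gt0.
have rs : r <= s by apply: ge_inf; [exists d | exists v].
have w_ge0 : forall i, 0 <= w i.
  apply: (@subinvariant_monotone v w s) => // i.
  rewrite -subr_ge0 -(subrK r s) mulrDl rw -addrA addrK.
  have : `|(s - r) * w i| <= 1.
    rewrite normrM ger0_norm ?subr_ge0 // -(mulVf (lt0r_neq0 M_gt0)).
    by rewrite ler_pM ?subr_ge0 // lerBlDl ltW.
  by rewrite ler_norml => /andP[+ _]; rewrite -lerBlDl sub0r lerNl.
have w_gt0 i : 0 < w i.
  rewrite lt_def w_ge0 andbT; apply/eqP => w0.
  have := rw i; rewrite w0 mulr0 => /eqP; rewrite eq_sym gt_eqF //.
  by rewrite ltr_pwDl // sumr_ge0 // => j _; rewrite mulr_ge0.
(* The decrement e = 1/(2M) satisfies e w_i < 1, so A w = r w - 1 < (r - e) w. *)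
suff /ge_inf : S (r - (2 * M)^-1).
  by move=> /(_ infS.2); rewrite leNgt ltrBlDr ltrDl invr_gt0 mulr_gt0.
exists w => // i; rewrite mulrBl rw -subr_gt0 addrAC addrK subr_gt0.
rewrite mulrC ltr_pdivrMr ?mulr_gt0 // mul1r.
apply: (@le_lt_trans _ _ M); first exact: le_trans (ler_norm _) (wM i).
by rewrite mulr_natl mulr2n ltrDl.
Qed.

End NonnegativeMatrices.

(** * Sums of nonnegative series *)

Section FiniteSums.
Context {R : realType} {I : choiceType}.
Local Open Scope classical_set_scope.
Local Open Scope ring_scope.
Variable h : I -> R.

(** Inclusion is required only for nonzero terms, so that index sets can be compared after dropping
    monomials that contribute nothing. *)
Lemma ler_sum_uniq (s s' : seq I) :
    (forall i, 0 <= h i) -> uniq s -> uniq s' ->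
    (forall i, i \in s -> h i != 0 -> i \in s') ->
  \sum_(i <- s) h i <= \sum_(i <- s') h i.
Proof.
move=> h_ge0 s_uniq s'_uniq ss'.
rewrite (bigID (mem s')) /= [X in _ + X]big1_seq ?addr0; last first.
  by move=> i /andP[si's is_]; apply: contraNeq si's; exact: ss'.
rewrite [leRHS](bigID (mem s)) /= -big_filter -[X in _ <= X + _]big_filter.
rewrite (perm_big [seq i <- s' | i \in s]) /=; first by rewrite lerDl sumr_ge0.
apply: uniq_perm; rewrite ?filter_uniq // => i.
by rewrite !mem_filter andbC.
Qed.

Lemma sum_le_esum (s : seq I) :
  uniq s -> ((\sum_(i <- s) h i)%:E <= \esum_(i in [set: I]) (h i)%:E)%E.
Proof.
move=> s_uniq; apply: esum_ge; exists [set` s]; first by split.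
by rewrite -fsbig_seq // sumEFin.
Qed.

Lemma esum_le_sum (M : R) :
    (forall s, uniq s -> \sum_(i <- s) h i <= M) ->
  (\esum_(i in [set: I]) (h i)%:E <= M%:E)%E.
Proof.
move=> hM; apply: ge_ereal_sup => _ [X [finX _] <-].
by rewrite fsbig_finite // sumEFin lee_fin hM.
Qed.

End FiniteSums.

(** * Coefficientwise comparison of polynomials up to a given degree *)

Section CoefficientwiseOrder.
Context {R : realType}.

(** Coefficients of a product up to degree [L] involve only coefficients of the factors up to [L].
    Nonnegativity is carried through the induction because multiplying inequalities requires it. *)
Lemma coef_prod_mono (I : Type) (s : seq I) (p q : I -> {poly R}) (L : nat) :
    (forall j i, (i <= L)%N -> 0 <= (p j)`_i <= (q j)`_i) ->
  forall i, (i <= L)%N ->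
    0 <= (\prod_(j <- s) p j)`_i <= (\prod_(j <- s) q j)`_i.
Proof.
move=> pq; elim/big_ind2: _ => [i _|p1 q1 p2 q2 h1 h2 i iL|j _]; last exact: pq.
  by rewrite coef1 ler0n lexx.
have hi (k : 'I_i.+1) : (k <= L)%N /\ (i - k <= L)%N.
  by split; [rewrite (leq_trans _ iL) // -ltnS |
    rewrite (leq_trans _ iL) ?leq_subr].
rewrite !coefM; apply/andP; split.
  apply: sumr_ge0 => k _; have [ha hb] := hi k.
  by have /andP[? _] := h1 _ ha; have /andP[? _] := h2 _ hb; exact: mulr_ge0.
apply: ler_sum => k _; have [ha hb] := hi k.
by have /andP[? ?] := h1 _ ha; have /andP[? ?] := h2 _ hb; exact: ler_pM.
Qed.

Lemma coef_prodX_mono (I : Type) (s : seq I) (k : I -> nat)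
    (p q : I -> {poly R}) (L : nat) :
    (forall j i, (i <= L)%N -> 0 <= (p j)`_i <= (q j)`_i) ->
  forall i, (i <= L)%N ->
    0 <= (\prod_(j <- s) p j ^+ k j)`_i <= (\prod_(j <- s) q j ^+ k j)`_i.
Proof.
move=> pq; apply: coef_prod_mono => j i iL.
(* A power is a product of equal factors indexed by [iota 0 (k j)]. *)
have := @coef_prod_mono _ (iota 0 (k j)) (fun=> p j) (fun=> q j) L.
move=> /(_ (fun _ => pq j) i iL).
by rewrite !big_const_seq !count_predT !size_iota !iter_mulr_1.
Qed.

(** A polynomial without constant term is divisible by X, so its k-th power is divisible by X^k. *)
Lemma coefX_eq0 (p : {poly R}) (k i : nat) :
  p`_0 = 0 -> (i < k)%N -> (p ^+ k)`_i = 0.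
Proof.
move=> p0; elim: k i => // k IH i ik.
rewrite exprS coefM big1 // => -[[|j] ji] _ /=.
  by rewrite p0 mul0r.
rewrite IH ?mulr0 // ltn_subLR; last by rewrite -ltnS.
by rewrite addSn ltnS (leq_trans _ (leq_addl _ _)) // -ltnS.
Qed.

Lemma coef_prodX_eq0 (J : finType) (p : J -> {poly R}) (k : J -> nat)
    (j : J) i :
  (p j)`_0 = 0 -> (i < k j)%N -> (\prod_j p j ^+ k j)`_i = 0.
Proof.
move=> p0 ik; rewrite (bigD1 j) //= coefM big1 // => -[l li] _ /=.
by rewrite coefX_eq0 ?mul0r // (leq_ltn_trans _ ik) // -ltnS.
Qed.

End CoefficientwiseOrder.

Section NonnegativeSeries.
Context {R : realType} {m : nat}.
Local Open Scope classical_set_scope.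
Local Open Scope ring_scope.
Variables (F : mpseries R m) (x : R) (y : 'I_m -> R).
Hypotheses (F_ge0 : forall n k, 0 <= F n k) (x_ge0 : 0 <= x).
Hypothesis y_ge0 : forall j, 0 <= y j.

Lemma mterm_ge0 p : (0 <= mterm F x y p)%E.
Proof.
rewrite lee_fin !mulr_ge0 ?exprn_ge0 //.
by apply: prodr_ge0 => j _; rewrite exprn_ge0.
Qed.

Lemma mconv_esum : mconv F x y <-> (esum [set: _] (mterm F x y) < +oo)%E.
Proof.
rewrite /mconv /summable (@eq_esum _ _ _ _ (mterm F x y)) // => p _.
by rewrite gee0_abs // mterm_ge0.
Qed.

Lemma mval_esum : mval F x y = fine (esum [set: _] (mterm F x y)).
Proof.
rewrite /mval (@eq_esum _ _ _ _ (mterm F x y)); last first.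
  move=> p pT; rewrite (ge0_funeposE (D := setT)) ?inE // => q _.
  exact: mterm_ge0.
rewrite (@esum1 _ _ _ (mterm F x y)^\-%E) ?sube0 // => p pT.
by rewrite (ge0_funenegE (D := setT)) ?inE // => q _; exact: mterm_ge0.
Qed.

Lemma mval_ge0 : 0 <= mval F x y.
Proof.
by rewrite mval_esum fine_ge0 // esum_ge0 // => p _; exact: mterm_ge0.
Qed.

End NonnegativeSeries.

(** * Substituting power series *)

Section Composition.
Context {R : realType} {m : nat}.
Local Open Scope classical_set_scope.
Local Open Scope ring_scope.
Variables (F : mpseries R m) (T : 'I_m -> nat -> R).
Hypotheses (F_ge0 : forall n k, 0 <= F n k) (T_ge0 : forall j n, 0 <= T j n).
Hypothesis T0 : forall j, T j 0%N = 0.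

(** The index set of [mcomp_coef], with ordinals turned into natural numbers so that it can be
    compared with arbitrary finite lists of exponents. *)
Definition exponent_box (N : nat) : seq (nat * {ffun 'I_m -> nat}) :=
  [seq (q.1 : nat, [ffun j => q.2 j : nat]) |
    q : 'I_N.+1 * {ffun 'I_m -> 'I_N.+1}].

Definition truncation (N : nat) (j : 'I_m) : {poly R} :=
  \poly_(l < N.+1) T j l.

(** A polynomial approximation of F(X, T(X)): its coefficients are compared with [mcomp_coef], its
    values with finite partial sums of F. *)
Definition truncated_comp (N : nat) (s : seq (nat * {ffun 'I_m -> nat})) :=
  \sum_(p <- s) F p.1 p.2 *: ('X^(p.1) * \prod_j truncation N j ^+ p.2 j).

Lemma exponent_box_uniq N : uniq (exponent_box N).
Proof.
rewrite map_inj_uniq ?enum_uniq // => -[n k] [n' k'] [/val_inj-> kk'].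
congr (_, _); apply/ffunP => j; apply: val_inj.
by have /ffunP/(_ j) := kk'; rewrite !ffunE.
Qed.

Lemma mem_exponent_box N (p : nat * {ffun 'I_m -> nat}) :
  (p.1 <= N)%N -> (forall j, p.2 j <= N)%N -> p \in exponent_box N.
Proof.
case: p => n k /= nN kN; apply/mapP.
exists (inord n, [ffun j => inord (k j)]); rewrite ?mem_enum //=.
rewrite inordK //; congr (_, _); apply/ffunP => j.
by rewrite !ffunE inordK // ltnS.
Qed.

Lemma mcomp_coefE N : mcomp_coef F T N =
  \sum_(p <- exponent_box N) F p.1 p.2 *
    (if (N < p.1)%N then 0 else (\prod_j truncation N j ^+ p.2 j)`_(N - p.1)).
Proof.
rewrite big_map big_enum /= /mcomp_coef pair_big /=.
apply: eq_bigr => -[n k] _ /=; rewrite ltnNge -ltnS ltn_ord /=.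
by congr (_ * (polyseq _)`__); apply: eq_bigr => j _; rewrite ffunE.
Qed.

Lemma coef_truncated_comp N s l : (truncated_comp N s)`_l =
  \sum_(p <- s) F p.1 p.2 *
    (if (l < p.1)%N then 0 else (\prod_j truncation N j ^+ p.2 j)`_(l - p.1)).
Proof. by rewrite coef_sum; apply: eq_bigr => p _; rewrite coefZ coefXnM. Qed.

(** The hypothesis with [minn] covers two cases: [N <= N'], where truncating later adds terms, and
    [L <= N'], where all degrees under consideration survive in the second truncation. *)
Lemma coef_truncation_mono N N' L j i :
    (minn N L <= N')%N -> (i <= L)%N ->
  0 <= (truncation N j)`_i <= (truncation N' j)`_i.
Proof.
move=> NN' iL; rewrite !coef_poly !ltnS.
case: leqP => iN; first by rewrite (leq_trans _ NN') ?leq_min ?iN // T_ge0 lexx.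
by rewrite lexx; case: ifP => _ /=; rewrite ?T_ge0.
Qed.

Lemma coef_truncation_prod_mono N N' L (k : {ffun 'I_m -> nat}) i :
    (minn N L <= N')%N -> (i <= L)%N ->
  0 <= (\prod_j truncation N j ^+ k j)`_i
    <= (\prod_j truncation N' j ^+ k j)`_i.
Proof.
move=> NN'; apply: coef_prodX_mono => j {}i; exact: coef_truncation_mono.
Qed.

Lemma comp_term_ge0 N l p : 0 <= F p.1 p.2 *
  (if (l < p.1)%N then 0 else (\prod_j truncation N j ^+ p.2 j)`_(l - p.1)).
Proof.
apply: mulr_ge0 => //; case: ifP => // _.
by have /andP[] :=
  coef_truncation_prod_mono p.2 (geq_minl N l) (leq_subr p.1 l).
Qed.

(** A monomial with an exponent above [l] does not reach degree [l], because the T_j have no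
    constant term; and truncating at [l] loses nothing in degree [l]. *)
Lemma coef_truncated_comp_le N s l : uniq s ->
  (truncated_comp N s)`_l <= mcomp_coef F T l.
Proof.
move=> s_uniq; rewrite coef_truncated_comp mcomp_coefE.
apply: le_trans
  (ler_sum_uniq (comp_term_ge0 l l) s_uniq (exponent_box_uniq l) _).
  apply: ler_sum => p _; rewrite ler_wpM2l //; case: ifP => // _.
  by have /andP[] :=
    coef_truncation_prod_mono p.2 (geq_minr N l) (leq_subr p.1 l).
move=> p _; case: ltnP => [_|pl]; first by rewrite mulr0 eqxx.
move=> p_neq0; apply: mem_exponent_box => // j; rewrite leqNgt.
apply: contra p_neq0 => lp; rewrite (coef_prodX_eq0 (j := j)) ?mulr0 //.
  by rewrite coef_poly /= T0.
exact: leq_ltn_trans (leq_subr _ _) lp.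
Qed.

Lemma exponent_boxP N p :
  p \in exponent_box N -> (p.1 <= N)%N /\ (forall j, p.2 j <= N)%N.
Proof.
move=> /mapP[[n k] _ ->] /=; split=> [|j]; rewrite ?ffunE -ltnS; exact: ltn_ord.
Qed.

(** The larger box contains the smaller one, and longer truncations only increase coefficients. *)
Lemma mcomp_coef_le N l : (l <= N)%N ->
  mcomp_coef F T l <= (truncated_comp N (exponent_box N))`_l.
Proof.
move=> lN; rewrite coef_truncated_comp mcomp_coefE.
apply: le_trans (ler_sum_uniq (comp_term_ge0 l l) (exponent_box_uniq l)
  (exponent_box_uniq N) _) _.
  move=> p /exponent_boxP[p1 p2] _.
  by apply: mem_exponent_box => [|j]; exact: leq_trans lN.
apply: ler_sum => p _; rewrite ler_wpM2l //; case: ifP => // _.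
have lN' : (minn l l <= N)%N by rewrite minnn.
by have /andP[] := coef_truncation_prod_mono p.2 lN' (leq_subr p.1 l).
Qed.

Lemma pseries_le_pval (f : nat -> R) (a : R) :
  (forall n, 0 <= f n) -> 0 <= a -> cvgn (pseries f a) ->
  forall N, \sum_(l < N) f l * a ^+ l <= pval f a.
Proof.
move=> f_ge0 a_ge0 fa N; rewrite -(big_mkord xpredT (fun l => f l * a ^+ l)).
apply: (nondecreasing_cvgn_le (u_ := pseries f a)) => //.
by apply: nondecreasing_series => n _ _; rewrite mulr_ge0 ?exprn_ge0.
Qed.

Lemma horner_truncation N j a :
  (truncation N j).[a] = pseries (T j) a N.+1.
Proof. by rewrite horner_poly /pseries /series /= big_mkord. Qed.

Lemma horner_truncated_comp N s a : (truncated_comp N s).[a] =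
  \sum_(p <- s) F p.1 p.2 * a ^+ p.1 * \prod_j pseries (T j) a N.+1 ^+ p.2 j.
Proof.
rewrite horner_sum; apply: eq_bigr => p _.
rewrite hornerZ hornerM hornerXn horner_prod mulrA; congr (_ * _).
by apply: eq_bigr => j _; rewrite horner_exp horner_truncation.
Qed.

Lemma mcomp_coef_ge0 l : 0 <= mcomp_coef F T l.
Proof. by rewrite mcomp_coefE sumr_ge0 // => p _; exact: comp_term_ge0. Qed.

Variable a : R.
Hypotheses (a_ge0 : 0 <= a) (Ta : forall j, cvgn (pseries (T j) a)).

Lemma pval_ge0 j : 0 <= pval (T j) a.
Proof.
by have := pseries_le_pval (T_ge0 j) a_ge0 (@Ta j) 0; rewrite big_ord0.
Qed.

(** Fix a finite list [s] of monomials. The truncated composition has coefficients below those of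
    F(x, T(x)), so its value at [a] is at most the sum of that series; then [N] tends to
    infinity. *)
Lemma esum_mcomp_le : cvgn (pseries (mcomp_coef F T) a) ->
  (esum [set: _] (mterm F a (fun j => pval (T j) a))
     <= (pval (mcomp_coef F T) a)%:E)%E.
Proof.
move=> Fa; apply: esum_le_sum => s s_uniq.
have cv : (truncated_comp N s).[a] @[N --> \oo] -->
    \sum_(p <- s) F p.1 p.2 * a ^+ p.1 * \prod_j pval (T j) a ^+ p.2 j.
  under eq_cvg do rewrite horner_truncated_comp.
  apply: (cvg_big (P := xpredT)) => [|p _]; first exact: add_continuous.
  apply: cvgM; first exact: cvg_cst.
  apply: (cvg_big (P := xpredT)) => [|j _]; first exact: mul_continuous.
  apply: (@cvg_comp _ _ _ (fun N => pseries (T j) a N.+1)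
    (fun z : R => z ^+ p.2 j));
    last exact: exprn_continuous.
  by rewrite (cvg_shiftS (pseries (T j) a)); exact: Ta.
apply: (cvgr_to_le cv); near=> N.
rewrite horner_coef.
apply: le_trans (pseries_le_pval mcomp_coef_ge0 a_ge0 Fa _).
apply: ler_sum => l _.
by rewrite ler_wpM2r ?exprn_ge0 // coef_truncated_comp_le.
Unshelve. all: by end_near. Qed.

(** The polynomial over the box of size [N] dominates the coefficients of the partial sum, while its
    value at [a] is at most a finite partial sum of F at (a, T(a)). *)
Lemma le_esum_mcomp N :
  ((pseries (mcomp_coef F T) a N)%:E
     <= esum [set: _] (mterm F a (fun j => pval (T j) a)))%E.
Proof.
apply: le_trans (sum_le_esum _ (exponent_box_uniq N)).
rewrite lee_fin.
apply: (@le_trans _ _ (truncated_comp N (exponent_box N)).[a]); last first.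
  rewrite horner_truncated_comp; apply: ler_sum => p _.
  apply: ler_wpM2l; first by rewrite mulr_ge0 ?exprn_ge0.
  have t_ge0 j : 0 <= pseries (T j) a N.+1.
    by apply: sumr_ge0 => n _; rewrite mulr_ge0 ?exprn_ge0.
  apply: ler_prod => j _; rewrite exprn_ge0 //= lerXn2r ?nnegrE ?pval_ge0 //.
  by rewrite /pseries /series /= big_mkord pseries_le_pval.
set Q := truncated_comp _ _.
(* A common length [M] lets the polynomial be split into its first [N] terms and a nonnegative
   tail. *)
have [M NM QM] : exists2 M, (N <= M)%N & (size Q <= M)%N.
  by exists (maxn N (size Q)); rewrite ?leq_maxl ?leq_maxr.
rewrite (horner_coef_wide _ QM) /pseries /series /=.
rewrite -(big_mkord xpredT (fun i => Q`_i * a ^+ i)).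
rewrite (big_cat_nat (leq0n N) NM) //= -[leLHS]addr0 lerD //.
  rewrite !big_mkord; apply: ler_sum => l _.
  by rewrite ler_wpM2r ?exprn_ge0 // mcomp_coef_le // ltnW.
apply: sumr_ge0 => l _; rewrite mulr_ge0 ?exprn_ge0 // coef_truncated_comp.
by apply: sumr_ge0 => p _; exact: comp_term_ge0.
Qed.

(** Since the right side is finite, this also yields convergence of F at (a, T(a)). *)
Lemma esum_mcomp : cvgn (pseries (mcomp_coef F T) a) ->
  esum [set: _] (mterm F a (fun j => pval (T j) a)) =
  (pval (mcomp_coef F T) a)%:E.
Proof.
move=> Fa; apply/eqP; rewrite eq_le esum_mcomp_le //=.
have := le_esum_mcomp; have := esum_mcomp_le Fa.
case: (esum _ _) => [v _ vle|//|_ /(_ 0%N)//].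
rewrite lee_fin; apply: (cvgr_to_le Fa); near=> N.
by have := vle N; rewrite lee_fin.
Unshelve. all: by end_near. Qed.

End Composition.

(** * Tangents and the Jacobian matrix *)

Section Convexity.
Context {R : realType}.
Local Open Scope classical_set_scope.
Local Open Scope ring_scope.

(** Writing f = g + (f - g) and expanding, the left side keeps the terms with at most one increment;
    the discarded ones are nonnegative. *)
Lemma ler_prod_tangent (n : nat) (f g : 'I_n -> R) :
    (forall i, 0 <= g i <= f i) ->
  \prod_i g i + \sum_j \prod_i (if i == j then f i - g i else g i)
    <= \prod_i f i.
Proof.
elim: n f g => [|n IH] f g gf; first by rewrite !big_ord0 addr0.
have /andP[g0 gf0] := gf ord0.
rewrite !big_ord_recl /=.
under [X in _ + (_ + X)]eq_bigr => j _.
  rewrite big_ord_recl /=.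
  under eq_bigr => i _ do rewrite (inj_eq lift_inj).
  over.
rewrite -mulr_sumr.
set P := \prod_i g _; set S := \sum_j _.
have PS : P + S <= \prod_i f (lift ord0 i) by apply: IH => i; exact: gf.
have S_ge0 : 0 <= S.
  apply: sumr_ge0 => j _; apply: prodr_ge0 => i _.
  by have /andP[? ?] := gf (lift ord0 i); case: ifP; rewrite ?subr_ge0.
rewrite addrA -mulrDl [g ord0 + _]addrC subrK.
apply: le_trans (ler_wpM2l (le_trans g0 gf0) PS).
by rewrite mulrDr lerD2l ler_wpM2r.
Qed.

(** The quotient (z^k - y^k) / (z - y) is a sum of k products, each at least y^(k-1). For k = 0 the
    truncated predecessor is harmless, as the factor k vanishes. *)
Lemma ler_exprn_tangent (y z : R) (k : nat) : 0 <= y -> y <= z ->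
  k%:R * y ^+ k.-1 * (z - y) <= z ^+ k - y ^+ k.
Proof.
move=> y_ge0 yz; rewrite subrXX mulrC ler_wpM2l ?subr_ge0 //.
rewrite mulr_natl -[X in _ *+ X]card_ord -sumr_const; apply: ler_sum => i _.
have ik : (i <= k.-1)%N.
  by rewrite -ltnS prednK // (leq_ltn_trans _ (ltn_ord i)).
rewrite -[in leLHS](subnK ik) exprD ler_wpM2r ?exprn_ge0 //.
by rewrite lerXn2r ?nnegrE // (le_trans y_ge0).
Qed.

Variables (m : nat) (F : mpseries R m).
Hypothesis F_ge0 : forall n k, 0 <= F n k.

Lemma mderiv_ge0 j n k : 0 <= mderiv j F n k.
Proof. by rewrite mulr_ge0. Qed.

(** One nonzero monomial bounds the sum from below. Convergence matters because [fine] sends an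
    infinite sum to 0. *)
Lemma mval_gt0 x (y : 'I_m -> R) : 0 < x -> (forall j, 0 < y j) ->
  mconv F x y -> mpseries_neq0 F -> 0 < mval F x y.
Proof.
move=> x_gt0 y_gt0; have x_ge0 := ltW x_gt0.
have y_ge0 j := ltW (y_gt0 j).
move=> /(mconv_esum F_ge0 x_ge0 y_ge0) Ffin [n [k Fnk]].
rewrite mval_esum // -lte_fin fineK; last first.
  by rewrite ge0_fin_numE // esum_ge0 // => p _; exact: mterm_ge0.
apply: lt_le_trans (sum_le_esum _ (isT : uniq [:: (n, k)])).
rewrite big_seq1 lte_fin /= !mulr_gt0 ?exprn_gt0 //.
  by rewrite lt_def Fnk F_ge0.
by apply: prodr_gt0 => j _; rewrite exprn_gt0.
Qed.

Variables (x x' : R) (y y' : 'I_m -> R).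
Hypotheses (x_ge0 : 0 <= x) (xx' : x <= x').
Hypotheses (y_ge0 : forall j, 0 <= y j) (yy' : forall j, y j <= y' j).

(* The [p]-th term of [(y' j - y j) * (d F / d y_j) (x, y)]. *)
Definition tangent_term (j : 'I_m) (p : nat * {ffun 'I_m -> nat}) : R :=
  F p.1 p.2 * x ^+ p.1 * \prod_l
    (if l == j then (p.2 l)%:R * y l ^+ (p.2 l).-1 * (y' l - y l)
     else y l ^+ p.2 l).

Lemma tangent_term_ge0 j p : 0 <= tangent_term j p.
Proof.
rewrite !mulr_ge0 ?exprn_ge0 //; apply: prodr_ge0 => l _.
by case: ifP; rewrite ?mulr_ge0 ?subr_ge0 ?exprn_ge0.
Qed.

(** Raising the j-th exponent by one is injective and matches each term of the derivative, times
    y'_j - y_j, with a tangent term. Dividing by this positive increment turns a finite tangent sum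
    into convergence of the derivative. *)
Lemma esum_mderiv_le j (e : R) : y j < y' j ->
    (esum [set: _] (fun p => (tangent_term j p)%:E) <= e%:E)%E ->
  (esum [set: _] (mterm (mderiv j F) x y) <= (e / (y' j - y j))%:E)%E.
Proof.
move=> yj e_ge; apply: esum_le_sum => s s_uniq.
rewrite ler_pdivlMr ?subr_gt0 // -lee_fin; apply: le_trans e_ge.
pose shift (p : nat * {ffun 'I_m -> nat}) :=
  (p.1, [ffun l => (p.2 l + (l == j))%N]).
have shift_inj : injective shift.
  move=> [n k] [n' k'] [-> kk']; congr (_, _); apply/ffunP => l.
  by have /ffunP/(_ l) := kk'; rewrite !ffunE => /addIn.
have := @sum_le_esum R _ (tangent_term j) (map shift s).
rewrite map_inj_uniq // => /(_ s_uniq); apply: le_trans.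
rewrite lee_fin big_map mulr_suml; apply: ler_sum => p _.
rewrite le_eqVlt; apply/orP; left; apply/eqP.
rewrite /tangent_term /shift /= /mderiv.
rewrite (bigD1 j) //= [in RHS](bigD1 j) //= eqxx !ffunE eqxx addn1 /=.
rewrite [in RHS](eq_bigr (fun l => y l ^+ p.2 l)); last first.
  by move=> l /negPf lj; rewrite lj ffunE lj addn0.
ring.
Qed.

(** The point moves in two stages: first from y to y' with x fixed, which gives the tangent terms;
    then from x to x', where only the gain of the pure monomial x^n0 is recorded. *)
Lemma ler_mterm_tangent (n0 : nat) p :
  F p.1 p.2 * x ^+ p.1 * \prod_j y j ^+ p.2 j
    + \sum_j tangent_term j p
    + (if p == (n0, [ffun=> 0%N]) then F p.1 p.2 * (x' ^+ n0 - x ^+ n0) else 0)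
  <= F p.1 p.2 * x' ^+ p.1 * \prod_j y' j ^+ p.2 j.
Proof.
have y'_ge0 j : 0 <= y' j := le_trans (y_ge0 j) (yy' j).
have xx'n n : x ^+ n <= x' ^+ n by rewrite lerXn2r ?nnegrE // (le_trans x_ge0).
have Py' : 0 <= \prod_j y' j ^+ p.2 j.
  by apply: prodr_ge0 => j _; rewrite exprn_ge0.
apply: (@le_trans _ _ (F p.1 p.2 * x ^+ p.1 * \prod_j y' j ^+ p.2 j +
  (if p == (n0, [ffun=> 0%N]) then F p.1 p.2 * (x' ^+ n0 - x ^+ n0) else 0))).
  rewrite lerD2r /tangent_term -mulr_sumr -mulrDr.
  rewrite ler_wpM2l ?mulr_ge0 ?exprn_ge0 //.
  have py j : 0 <= y j ^+ p.2 j <= y' j ^+ p.2 j.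
    by rewrite exprn_ge0 //= lerXn2r ?nnegrE.
  apply: le_trans (ler_prod_tangent py); rewrite lerD2l.
  apply: ler_sum => j _; apply: ler_prod => l _; case: ifP => _.
    by rewrite ler_exprn_tangent // !mulr_ge0 ?exprn_ge0 ?subr_ge0.
  by rewrite exprn_ge0 //=.
case: eqP => [->/=|_]; last first.
  by rewrite addr0 ler_wpM2r // ler_wpM2l.
rewrite big1 => [|j _]; last by rewrite ffunE.
by rewrite !mulr1 -mulrDr addrC subrK.
Qed.

(** The numbers [e j] stand for (y'_j - y_j) times the partial derivatives. They are kept undivided
    because the strict increase y_j < y'_j is itself deduced from this inequality. *)
Lemma mval_tangent_le (n0 : nat) (v v' : R) :
    esum [set: _] (mterm F x y) = v%:E ->
    esum [set: _] (mterm F x' y') = v'%:E ->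
  exists2 e : 'I_m -> R,
    forall j, 0 <= e j /\
      esum [set: _] (fun p => (tangent_term j p)%:E) = (e j)%:E
    & v + \sum_j e j + F n0 [ffun=> 0%N] * (x' ^+ n0 - x ^+ n0) <= v'.
Proof.
move=> Ev Ev'.
pose gain (p : nat * {ffun 'I_m -> nat}) : R :=
  if p == (n0, [ffun=> 0%N]) then F p.1 p.2 * (x' ^+ n0 - x ^+ n0) else 0.
have gain_ge0 p : 0 <= gain p.
  rewrite /gain; case: ifP => // _; rewrite mulr_ge0 ?subr_ge0 //.
  by rewrite lerXn2r ?nnegrE // (le_trans x_ge0).
have m_ge0 p : (0 <= mterm F x y p)%E by exact: mterm_ge0.
have t_ge0 j p : (0 <= (tangent_term j p)%:E)%E.
  by rewrite lee_fin tangent_term_ge0.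
have st_ge0 p : (0 <= \sum_j (tangent_term j p)%:E)%E by apply: sume_ge0.
(* The inequality is first proved in the extended reals; finiteness of each tangent sum then follows
   from the bound [v']. *)
have main : (v%:E + \sum_j esum [set: _] (fun p => (tangent_term j p)%:E) +
    (F n0 [ffun=> 0%N] * (x' ^+ n0 - x ^+ n0))%:E <= v'%:E)%E.
  apply: (@le_trans _ _ (esum [set: _] (fun p => mterm F x y p +
      \sum_j (tangent_term j p)%:E + (gain p)%:E))%E); last first.
    rewrite -Ev'; apply: le_esum => p _.
    by rewrite sumEFin -!EFinD lee_fin; exact: ler_mterm_tangent.
  rewrite esumD; last 2 first.
  - by move=> p _; rewrite adde_ge0.
  - by move=> p _; rewrite lee_fin.
  rewrite esumD // esum_sum // Ev leeD2l //.
  have := sum_le_esum gain (isT : uniq [:: (n0, [ffun=> 0%N])]).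
  by rewrite big_seq1 {1}/gain eqxx.
have E_ge0 j : (0 <= esum [set: _] (fun p => (tangent_term j p)%:E))%E.
  by rewrite esum_ge0.
have g_ge0 : (0 <= (F n0 [ffun=> 0%N] * (x' ^+ n0 - x ^+ n0))%:E)%E.
  by have := gain_ge0 (n0, [ffun=> 0%N]); rewrite /gain eqxx lee_fin.
have v_ge0 : (0 <= v%:E)%E by rewrite -Ev; apply: esum_ge0 => p _; exact: m_ge0.
exists (fun j => fine (esum [set: _] (fun p => (tangent_term j p)%:E))).
  move=> j; rewrite fine_ge0 //; split=> //; rewrite fineK // ge0_fin_numE //.
  apply: le_lt_trans (ltry v'); apply: le_trans main.
  rewrite -[leLHS]adde0 leeD // -[leLHS]add0e leeD //.
  by rewrite (bigD1 j) //= leeDl // sume_ge0.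
rewrite -lee_fin; apply: le_trans main; rewrite !EFinD leeD2r // leeD2l //.
rewrite -sumEFin; apply: lee_sum => j _.
by case: (esum _ _) (E_ge0 j) => //= _; rewrite leey.
Qed.

End Convexity.

(** * Spectrum of the Jacobian matrix of a well-conditioned system *)

Section System.
Context {R : realType} {m : nat}.
Local Open Scope classical_set_scope.
Local Open Scope ring_scope.
Variables (G : 'I_m -> mpseries R m).
Hypothesis G_wc : well_conditioned G.

(** A nonzero second derivative gives an edge out of [i0]; any other vertex has a path to [i0],
    whose first step is an edge. Nonlinearity is essential for m = 1, where connectedness is
    vacuous. *)
Lemma exists_dependency_edge i : exists j, dependency_edge G i j.
Proof.
have [i0 [j0 [k0 [n [k Hnk]]]]] := wc_nonlinear G_wc.
have [->|ii0] := eqVneq i i0.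
  exists k0; apply/asboolP; exists n, [ffun l => (k l + (l == j0))%N].
  apply: contraNneq Hnk => Hk; apply/eqP.
  by transitivity ((k j0).+1%:R * 0 : R);
    [rewrite -[X in _ * X]Hk | exact: mulr0].
have /connectP[[|j p] /=] := wc_irreducible G_wc i i0.
  by move=> _ E; rewrite E eqxx in ii0.
by case/andP => ij _ _; exists j.
Qed.

Variables (a : R) (b : 'I_m -> R).
Hypotheses (a_gt0 : 0 < a) (b_gt0 : forall j, 0 < b j).

Lemma sys_jacobian_ge0 i j : 0 <= sys_jacobian G a b i j.
Proof.
rewrite mxE mval_ge0 ?ltW // => [n k|l]; last exact: ltW.
by apply: mderiv_ge0 => n' k'; exact: wc_nonneg.
Qed.

(** A real [sup] dominates its set only if the set is bounded; the sum of all entries bounds every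
    eigenvalue, by constant weights. *)
Lemma eigenvalue_le_Lambda l :
  eigenvalue (sys_jacobian G a b) l -> l <= Lambda G a b.
Proof.
move=> Jl; apply: ub_le_sup => //.
exists (\sum_i \sum_j sys_jacobian G a b i j) => l' /= Jl'.
apply: le_trans (ler_norm _) _.
apply: (eigenvalue_le_weighted (v := fun=> 1) sys_jacobian_ge0 _ _ Jl') => // i.
under [leLHS]eq_bigr do rewrite mulr1.
rewrite mulr1 [leRHS](bigD1 i) //= lerDl sumr_ge0 // => k _.
by apply: sumr_ge0 => j _; exact: sys_jacobian_ge0.
Qed.

Lemma Lambda_gt0 : (0 < m)%N -> sys_jacobian_conv G a b -> 0 < Lambda G a b.
Proof.
move=> m_gt0 Jconv.
pose r i := \sum_j sys_jacobian G a b i j.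
have r_gt0 i : 0 < r i.
  have [j /asboolP ij] := exists_dependency_edge i.
  rewrite /r (bigD1 j) //= ltr_pwDl //.
    rewrite mxE mval_gt0 //.
    by move=> n k; apply: mderiv_ge0; exact: wc_nonneg.
  by apply: sumr_ge0 => k _; exact: sys_jacobian_ge0.
have [k _ k_min] :=
  @Order.TotalTheory.arg_minP _ R _ (Ordinal m_gt0) xpredT r isT.
have [l rl Jl] :=
  eigenvalue_ge_row_sums sys_jacobian_ge0 m_gt0 (fun i => k_min i isT).
exact: lt_le_trans (lt_le_trans (r_gt0 k) rl) (eigenvalue_le_Lambda Jl).
Qed.

Lemma Lambda_lt1 (v : 'I_m -> R) : (0 < m)%N -> sys_jacobian_conv G a b ->
    (forall i, 0 < v i) ->
    (forall i, \sum_j sys_jacobian G a b i j * v j < v i) ->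
  Lambda G a b < 1.
Proof.
move=> m_gt0 Jconv v_gt0 Jv.
(* Eigenvalues below 1 alone would only give a supremum at most 1; the largest ratio (J v)_i / v_i
   is a common bound strictly below 1. *)
pose q i := (\sum_j sys_jacobian G a b i j * v j) / v i.
have [k _ k_max] :=
  @Order.TotalTheory.arg_maxP _ R _ (Ordinal m_gt0) xpredT q isT.
apply: (@le_lt_trans _ _ (q k)); last by rewrite /q ltr_pdivrMr // mul1r.
(* The set of eigenvalues must be nonempty here; row sums at least 0 provide an element. *)
apply: ge_sup.
  pose r i := \sum_j sys_jacobian G a b i j.
  have [l _ Jl] := eigenvalue_ge_row_sums (d := 0) sys_jacobian_ge0 m_gt0
    (fun i => sumr_ge0 _ (fun j _ => sys_jacobian_ge0 i j)).
  by exists l.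
move=> l /= Jl; apply: le_trans (ler_norm _) _.
apply: (eigenvalue_le_weighted sys_jacobian_ge0 v_gt0 _ Jl) => i.
by rewrite -ler_pdivrMr //; exact: k_max.
Qed.

End System.

(** * Univariate series inside the radius of convergence, and the conclusion *)

Lemma conv_radius_cvg (R : realType) (f : nat -> R) (rho a : R) :
    (forall n, 0 <= f n) -> conv_radius f = rho%:E -> 0 <= a -> a < rho ->
  cvgn (pseries f a).
Proof.
move=> f_ge0 f_rho a_ge0 a_rho.
have : (a%:E < conv_radius f)%E by rewrite f_rho lte_fin.
move=> /ereal_sup_gt[_ [r [r_ge0 fr] <-]]; rewrite lte_fin => ar.
apply: series_le_cvg fr => n; rewrite ?mulr_ge0 ?exprn_ge0 //.
by rewrite ler_wpM2l // lerXn2r ?nnegrE // ltW.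
Qed.

Lemma ler_pval (R : realType) (f : nat -> R) (a a' : R) :
    (forall n, 0 <= f n) -> 0 <= a -> a <= a' ->
    cvgn (pseries f a) -> cvgn (pseries f a') ->
  pval f a <= pval f a'.
Proof.
move=> f_ge0 a_ge0 aa' fa fa'; apply: (cvgr_to_le fa); near=> N.
have a'_ge0 := le_trans a_ge0 aa'.
apply: le_trans (pseries_le_pval f_ge0 a'_ge0 fa' N).
rewrite /pseries /series /= big_mkord; apply: ler_sum => l _.
by rewrite ler_wpM2l // lerXn2r ?nnegrE.
Unshelve. all: by end_near. Qed.

Theorem lemma10 (R : realType) (m : nat) (m_gt0 : (0 < m)%N)
    (G : 'I_m -> mpseries R m) (T : 'I_m -> nat -> R)
    (rho : R) (tau : 'I_m -> R)
    (hG : well_conditioned G) (hT : standard_solution G T)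
    (hrho : extreme_point T rho tau) :
  (forall (a : R) (b : 'I_m -> R),
     characteristic_point G a b -> 1 <= Lambda G a b) /\
  (forall a : R, 0 < a -> a < rho ->
     sys_jacobian_conv G a (fun i => pval (T i) a) /\
     0 < Lambda G a (fun i => pval (T i) a) /\
     Lambda G a (fun i => pval (T i) a) < 1).
Proof.
have G_ge0 := wc_nonneg hG; have T_ge0 := std_nonneg hT.
split=> [a b [a_gt0 b_gt0 _ _ _ det0]|a a_gt0 a_rho].
  apply: eigenvalue_le_Lambda => //.
  by rewrite eigenvalueE_unitmx unitmxE det0 unitr0.
have Tcvg c i (c_gt0 : 0 < c) (c_rho : c < rho) : cvgn (pseries (T i) c).
  exact: conv_radius_cvg (T_ge0 i) (hrho i).1 (ltW c_gt0) c_rho.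
(* The formal identity T = G(x, T) becomes an identity of values at every 0 < c < rho, convergence
   of G_i included. *)
have GT c i : 0 < c -> c < rho ->
    esum [set: _] (mterm (G i) c (fun j => pval (T j) c)) = (pval (T i) c)%:E.
  move=> c_gt0 c_rho.
  have TG : mcomp_coef (G i) T = T i by apply/funext => n; rewrite -(std_eq hT).
  rewrite (esum_mcomp (G_ge0 i) T_ge0 (std_0 hT) (ltW c_gt0)) ?TG //.
    by move=> j; exact: Tcvg.
  exact: Tcvg.
(* Any second point strictly between [a] and [rho] would do. *)
pose a' := (a + rho) / 2.
have aa' : a < a' := (midf_lt a_rho).1.
have a'_rho : a' < rho := (midf_lt a_rho).2.
have a'_gt0 := lt_trans a_gt0 aa'.
pose y j := pval (T j) a; pose y' j := pval (T j) a'.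
have y_ge0 j : 0 <= y j.
  by apply: (pval_ge0 T_ge0 (ltW a_gt0)) => i; exact: Tcvg.
have yy' j : y j <= y' j.
  exact: ler_pval (T_ge0 j) (ltW a_gt0) (ltW aa') (Tcvg _ j a_gt0 a_rho)
    (Tcvg _ j a'_gt0 a'_rho).
have y_gt0 i : 0 < y i.
  have [n Gn] := wc_y0 hG i.
  rewrite -lte_fin -GT //.
  apply: lt_le_trans (sum_le_esum _ (isT : uniq [:: (n, [ffun=> 0%N])])).
  rewrite big_seq1 lte_fin /= big1 => [|j _]; last by rewrite ffunE.
  by rewrite mulr1 mulr_gt0 ?exprn_gt0 // lt_def Gn G_ge0.
have tangent i : exists2 e : 'I_m -> R,
    forall j, 0 <= e j /\
      esum [set: _] (fun p => (tangent_term (G i) a y y' j p)%:E) = (e j)%:E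
    & y i + \sum_j e j < y' i.
  have [n Gn] := wc_y0 hG i.
  have [e e_ge0 ey] := mval_tangent_le (G_ge0 i) (ltW a_gt0) (ltW aa') y_ge0 yy'
    n (GT a i a_gt0 a_rho) (GT a' i a'_gt0 a'_rho).
  exists e => //; apply: lt_le_trans ey; rewrite ltrDl mulr_gt0 //.
    by rewrite lt_def Gn G_ge0.
  rewrite subr_gt0 ltrXn2r ?nnegrE ?ltW //.
  (* The exponent [n] is nonzero because G(0, y) = 0, so a^n < a'^n strictly. *)
  by apply: contraNneq Gn => ->; rewrite (wc_x0 hG).
have yy'_lt i : y i < y' i.
  have [e e_ge0 ey] := tangent i; apply: le_lt_trans ey.
  by rewrite lerDl sumr_ge0 // => j _; have [] := e_ge0 j.
have dG_ge0 i j n k : 0 <= mderiv j (G i) n k.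
  by apply: mderiv_ge0; exact: G_ge0.
(* Now that every T_j is known to increase strictly, division by y'_j - y_j gives both convergence
   of the Jacobian entry and its bound. *)
have Jac i j e :
    esum [set: _] (fun p => (tangent_term (G i) a y y' j p)%:E) = e%:E ->
    mconv (mderiv j (G i)) a y /\ mval (mderiv j (G i)) a y * (y' j - y j) <= e.
  move=> Ee.
  have := @esum_mderiv_le _ _ (G i) a y y' j e (yy'_lt j).
  rewrite Ee lexx => /(_ isT) le_e.
  have fin : (esum [set: _] (mterm (mderiv j (G i)) a y) < +oo)%E.
    exact: le_lt_trans le_e (ltry _).
  split; first by apply/(mconv_esum (dG_ge0 i j) (ltW a_gt0) y_ge0).
  rewrite -ler_pdivlMr ?subr_gt0 // (mval_esum (dG_ge0 i j) (ltW a_gt0) y_ge0).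
  rewrite -lee_fin fineK // ge0_fin_numE // esum_ge0 // => p _.
  exact: mterm_ge0 (dG_ge0 i j) (ltW a_gt0) y_ge0 p.
have Jconv : sys_jacobian_conv G a y.
  move=> i j; have [e /(_ j)[_ Ee] _] := tangent i; exact: (Jac i j _ Ee).1.
split=> //; split; first exact: Lambda_gt0.
apply: (Lambda_lt1 hG a_gt0 y_gt0 (v := fun j => y' j - y j)) => // i.
  by rewrite subr_gt0.
have [e He ey] := tangent i.
rewrite ltrBrDl; apply: le_lt_trans ey; rewrite lerD2l.
apply: ler_sum => j _; have [_ Ee] := He j.
by rewrite mxE; exact: (Jac i j _ Ee).2.
Qed.
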